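(* Let $R$ be a ring, let $\Sigma=\{\sigma_1,\dots,\sigma_n\}$ be a family of endomorphisms of $R$, and let $\Delta=\{\delta_1,\dots,\delta_n\}$ be a family of $\Sigma$-derivations of $R$ (that is, $\delta_i$ is a $\sigma_i$-derivation of $R$ for each $1\le i\le n$). Then $R$ is $\Sigma$-rigid if and only if $R$ is weak $\Sigma$-rigid and reduced.
   Context: Rings are associative with unity, not necessarily commutative. $\mathbb{N}$ includes $0$. For a ring $R$, ${\rm nil}(R)$ denotes the set of nilpotent elements of $R$; $R$ is reduced if ${\rm nil}(R)=\{0\}$. For $\theta=(\theta_1,\dots,\theta_n)\in\mathbb{N}^n$, $\sigma^{\theta}:=\sigma_1^{\theta_1}\circ\cdots\circ\sigma_n^{\theta_n}$, with $\sigma_j^0={\rm id}_R$. A $\sigma_i$-derivation is an additive map $\delta_i:R\to R$ with $\delta_i(rs)=\sigma_i(r)\delta_i(s)+\delta_i(r)s$ for all $r,s\in R$. $R$ is $\Sigma$-rigid if $\Sigma$ is a rigid endomorphisms family of $R$, meaning: for every $r\in R$ and every $\alpha\in\mathbb{N}^n$, $r\sigma^{\alpha}(r)=0$ implies $r=0$. $R$ is weak $\Sigma$-rigid if for each $a\in R$ and every $\theta\in\mathbb{N}^n$: $a\sigma^{\theta}(a)\in{\rm nil}(R)$ if and only if $a\in{\rm nil}(R)$. *)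

(* Defs.v *)
From HB Require Import structures.
From mathcomp Require Import all_boot all_order all_algebra.

Set Implicit Arguments.
Unset Strict Implicit.
Unset Printing Implicit Defensive.

Import GRing.Theory.
Local Open Scope ring_scope.

(* Rings are [pzRingType]: associative and unital, neither commutativity nor
   1 != 0 is assumed. *)

(* The exponent k = 0 only matters in the zero ring, where x = 0 anyway. *)
Definition nilpotent_elt (R : pzRingType) (x : R) : Prop :=
  exists k : nat, x ^+ k = 0.

Definition reduced_ring (R : pzRingType) : Prop :=
  forall x : R, nilpotent_elt x <-> x = 0.

(* sigma^theta = sigma_0^(theta 0) \o ... \o sigma_(n-1)^(theta (n-1)); the
   big operator is a right fold, so the order of composition is the displayed
   one (the endomorphisms need not commute). *)
Definition endo_pow (R : pzRingType) (n : nat)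
    (sigma : 'I_n -> {rmorphism R -> R}) (theta : 'I_n -> nat) : R -> R :=
  \big[(fun f g : R -> R => f \o g)/id]_(i < n) iter (theta i) (sigma i).

Definition skew_derivation (R : pzRingType)
    (sigma : {rmorphism R -> R}) (delta : R -> R) : Prop :=
  {morph delta : r s / r + s} /\
  forall r s : R, delta (r * s) = sigma r * delta s + delta r * s.

Definition Sigma_rigid (R : pzRingType) (n : nat)
    (sigma : 'I_n -> {rmorphism R -> R}) : Prop :=
  forall (r : R) (alpha : 'I_n -> nat), r * endo_pow sigma alpha r = 0 -> r = 0.

Definition weak_Sigma_rigid (R : pzRingType) (n : nat)
    (sigma : 'I_n -> {rmorphism R -> R}) : Prop :=
  forall (a : R) (theta : 'I_n -> nat),
    nilpotent_elt (a * endo_pow sigma theta a) <-> nilpotent_elt a.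

(* Main.v *)
Require Import Defs.
From mathcomp Require Import all_boot all_order all_algebra.

(** A Sigma-rigid ring is reduced: the exponent family [alpha = 0] gives
    [endo_pow sigma alpha = id], so rigidity yields [r * r = 0 -> r = 0], and
    squaring repeatedly reaches any power of [r].  In a reduced ring
    the nilpotent elements are just [0], and there weak Sigma-rigidity reads
    [a * sigma^theta(a) = 0 <-> a = 0], which is Sigma-rigidity together with
    the trivial implication at [a = 0]. *)

Import GRing.Theory.
Local Open Scope ring_scope.

Lemma reduced_of_sqr_eq0 (R : pzRingType) :
  (forall r : R, r * r = 0 -> r = 0) -> reduced_ring R.
Proof.
move=> sq0 x; split=> [[k xk0] | ->]; last by exists 1%N.
(* Since [k <= 2 ^ k], the exponent may be taken to be a power of two. *)
have x2k0 : x ^+ (2 ^ k) = 0.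
  by rewrite -(subnK (ltnW (ltn_expl k (ltnSn 1)))) exprD xk0 mulr0.
elim: k {xk0} x2k0 => [|k IHk]; first by rewrite expr1.
by rewrite expnSr exprM expr2 => /sq0.
Qed.

Lemma endo_pow_exp0 (R : pzRingType) (n : nat)
    (sigma : 'I_n -> {rmorphism R -> R}) (r : R) :
  endo_pow sigma (fun=> 0%N) r = r.
Proof.
rewrite /endo_pow; apply: (big_ind (fun f : R -> R => f r = r)) => //.
by move=> f g /= fr ->.
Qed.

Lemma Sigma_rigid_reduced (R : pzRingType) (n : nat)
    (sigma : 'I_n -> {rmorphism R -> R}) :
  Sigma_rigid sigma -> reduced_ring R.
Proof.
move=> rig; apply: reduced_of_sqr_eq0 => r rr0.
by apply: (rig r (fun=> 0%N)); rewrite endo_pow_exp0.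
Qed.

Theorem theorem3p4 (R : pzRingType) (n : nat)
    (sigma : 'I_n -> {rmorphism R -> R}) (delta : 'I_n -> R -> R)
    (hdelta : forall i : 'I_n, skew_derivation (sigma i) (delta i)) :
  Sigma_rigid sigma <-> weak_Sigma_rigid sigma /\ reduced_ring R.
Proof.
split=> [rig | [weak red] r alpha rar0].
  have red := Sigma_rigid_reduced _ _ _ rig.
  split=> // a theta; split=> /red a0; apply/red; first exact: rig a0.
  by rewrite a0 mul0r.
by apply/red/(weak r alpha)/red.
Qed.
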